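(* Let $m\ge1$, $\vec\mu=(\mu_1,\dots,\mu_m)\in\mathbb{R}_{>0}^m$, $\vec\sigma=(\sigma_1,\dots,\sigma_m)\in\mathbb{R}_{\ge0}^m$, $r_j=\sigma_j/\mu_j$ and $r_{\max}=\max_j r_j$. (i) Let $A$ be the mechanism that sells each item $j$ separately, posting for item $j$ an independent random price drawn from the log-lottery $P^{\log}_{\mu_j,\sigma_j}$. Then $\mathrm{OPT}(F)/\mathrm{REV}(A;F)\le\rho(r_{\max})$ for every $F\in\mathbb{F}_{\vec\mu,\vec\sigma}$; in particular $\mathrm{APX}(\vec\mu,\vec\sigma)\le\rho(r_{\max})$. (ii) Let $\bar\mu=\sum_j\mu_j$, $\bar\sigma=\sqrt{\sum_j\sigma_j^2}$, $\bar r=\bar\sigma/\bar\mu$, and let $B$ be the mechanism that offers the bundle of all $m$ items at a single random price drawn from $P^{\log}_{\bar\mu,\bar\sigma}$. Then $\mathrm{OPT}(F)/\mathrm{REV}(B;F)\le\rho(\bar r)$ for every $F\in\mathbb{F}_{\vec\mu,\vec\sigma}$ that is a product distribution (i.e. the item values are independent).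
   Context: One buyer with additive valuation for $m$ items; the value vector $\vec v=(v_1,\dots,v_m)\in\mathbb{R}_{\ge0}^m$ is drawn from a joint distribution $F$. $\mathbb{F}_{\vec\mu,\vec\sigma}$ is the class of all joint distributions on $\mathbb{R}^m_{\ge0}$ whose $j$-th marginal has mean $\mu_j$ and standard deviation at most $\sigma_j$, for each $j$ (no independence assumed). A mechanism is a pair $(x,\pi)$ with $x:\mathbb{R}^m_{\ge0}\to[0,1]^m$ and $\pi:\mathbb{R}^m_{\ge0}\to\mathbb{R}_{\ge0}$; it is truthful if $x(\vec v)\cdot\vec v-\pi(\vec v)\ge x(\vec w)\cdot\vec v-\pi(\vec w)$ and $x(\vec v)\cdot\vec v-\pi(\vec v)\ge0$ for all $\vec v,\vec w$. $\mathrm{REV}(A;F)=\mathbb{E}_{\vec v\sim F}[\pi(\vec v)]$, $\mathrm{OPT}(F)=\sup$ of $\mathrm{REV}$ over truthful mechanisms, and $\mathrm{APX}(\vec\mu,\vec\sigma)=\inf_A\sup_{F\in\mathbb{F}_{\vec\mu,\vec\sigma}}\mathrm{OPT}(F)/\mathrm{REV}(A;F)$ over truthful $A$ (zero denominators give $+\infty$). A posted (random) price mechanism sells an item or bundle to the buyer iff the buyer's value for it is at least the drawn price. For $\mu>0,\sigma\ge0$, the log-lottery $P^{\log}_{\mu,\sigma}$ is the random price on $[\pi_1,\pi_2]$ with cdf $x\mapsto\frac{\pi_2\ln(x/\pi_1)-(x-\pi_1)}{\pi_2\ln(\pi_2/\pi_1)-(\pi_2-\pi_1)}$, where $\pi_1,\pi_2$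 are the unique solutions of $\pi_1(1+\ln(\pi_2/\pi_1))=\mu$, $\pi_1(2\pi_2-\pi_1)=\mu^2+\sigma^2$ (for $\sigma=0$ it is the deterministic price $\mu$). For $r\ge0$, $\rho(r)$ is the unique positive solution $\rho$ of $\frac{1}{\rho^2}(2e^{\rho-1}-1)=r^2+1$. *)

(* Defs.v *)
From HB Require Import structures.
From mathcomp Require Import all_boot all_order all_algebra.
From mathcomp Require Import all_classical all_reals all_analysis.

Set Implicit Arguments.
Unset Strict Implicit.
Unset Printing Implicit Defensive.

Import Order.TTheory GRing.Theory Num.Theory.
Local Open Scope classical_set_scope.
Local Open Scope ring_scope.

Section Defs.
Variable R : realType.
Variable m : nat.

(* value vectors: m.-tuple R, with the product (Borel) sigma-algebra of the
   library (generated by the coordinate projections tnth). *)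
Definition vals := (m.-tuple R).

Definition nonneg_vec (v : vals) : Prop := forall j : 'I_m, 0 <= tnth v j.

Record mechanism := Mechanism {
  alloc : vals -> 'I_m -> R ;
  pay : vals -> R }.

Definition utility (M : mechanism) (report : vals) (v : vals) : R :=
  \sum_(j < m) alloc M report j * tnth v j - pay M report.

Definition truthful (M : mechanism) : Prop :=
  (forall v, nonneg_vec v -> forall j, 0 <= alloc M v j <= 1) /\
  (forall v, nonneg_vec v -> 0 <= pay M v) /\
  (forall v w, nonneg_vec v -> nonneg_vec w ->
     utility M w v <= utility M v v) /\
  (forall v, nonneg_vec v -> 0 <= utility M v v).

Definition admissible (M : mechanism) : Prop :=
  truthful M /\ measurable_fun [set: vals] (pay M).

Definition REV (M : mechanism) (F : probability vals R) : \bar R :=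
  (\int[F]_v (pay M v)%:E)%E.

Definition OPT (F : probability vals R) : \bar R :=
  ereal_sup [set REV M F | M in admissible].

Definition eratio (a b : \bar R) : \bar R :=
  match b with
  | EFin r => if r == 0 then +oo%E else (a * (r^-1)%:E)%E
  | +oo%E => 0%E
  | -oo%E => +oo%E
  end.

Definition in_class (mu sigma : 'I_m -> R) (F : probability vals R) : Prop :=
  F [set v | nonneg_vec v] = 1%E /\
  forall j : 'I_m,
    (\int[F]_v (tnth v j)%:E = (mu j)%:E)%E /\
    (\int[F]_v ((tnth v j - mu j) ^+ 2)%:E <= (sigma j ^+ 2)%:E)%E.

Definition product_dist (F : probability vals R) : Prop :=
  forall B : 'I_m -> set R, (forall j, measurable (B j)) ->
    F [set v | forall j, B j (tnth v j)] =
    (\prod_(j < m) F [set v | B j (tnth v j)])%E.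

Definition APX (mu sigma : 'I_m -> R) : \bar R :=
  ereal_inf [set ereal_sup [set eratio (OPT F) (REV M F) | F in in_class mu sigma]
            | M in admissible].

(* Separate selling: item j is offered at a random price drawn from P j
   (sold iff price <= v_j); written in lottery form (expected allocation,
   expected payment). *)
Definition separate_posted (P : 'I_m -> probability R R) : mechanism :=
  Mechanism (fun v j => fine (P j [set p : R | (p <= tnth v j)%R]))
            (fun v => \sum_(j < m)
                 fine (\int[P j]_(p in [set p : R | (p <= tnth v j)%R]) p%:E)%E).

Definition bundle_posted (Q : probability R R) : mechanism :=
  Mechanism (fun v _ => fine (Q [set p : R | (p <= \sum_(i < m) tnth v i)%R]))
            (fun v => fine (\int[Q]_(p in [set p : R | (p <= \sum_(i < m) tnth v i)%R])
                              p%:E)%E).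

End Defs.

Section LogLottery.
Variable R : realType.

Definition loglottery_params (mu sigma p1 p2 : R) : Prop :=
  0 < p1 /\ 0 < p2 /\
  p1 * (1 + ln (p2 / p1)) = mu /\ p1 * (2 * p2 - p1) = mu ^+ 2 + sigma ^+ 2.

Definition loglottery_cdf (mu sigma p1 p2 x : R) : R :=
  if sigma == 0 then (if mu <= x then 1 else 0)
  else if x < p1 then 0
  else if p2 <= x then 1
  else (p2 * ln (x / p1) - (x - p1)) / (p2 * ln (p2 / p1) - (p2 - p1)).

Definition is_loglottery (mu sigma : R) (P : probability R R) : Prop :=
  exists p1 p2, loglottery_params mu sigma p1 p2 /\
    forall x : R, P [set y | y <= x] = (loglottery_cdf mu sigma p1 p2 x)%:E.

Definition is_rho (r rho : R) : Prop :=
  0 < rho /\ (2 * expR (rho - 1) - 1) / rho ^+ 2 = r ^+ 2 + 1.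

End LogLottery.

(* Main.v *)
(* OPT(F) is at most the welfare, the sum of the means, since the buyer's utility
   is nonnegative.  Against a log-lottery price on [p1, p2] the expected payment
   of a buyer of value x is bounded below by a concave quadratic in x, equal to
   it on [p1, p2]; averaging it uses only the mean and the variance of x,
   and the equations defining p1, p2 turn the average into p1.  Those equations
   also say that mu / p1 = rho(sigma / mu), and rho is increasing.  For the
   bundle, independence gives the variance of the total value. *)
Require Import Defs.
From HB Require Import structures.
From mathcomp Require Import all_boot all_order all_algebra.
From mathcomp Require Import all_classical all_reals all_analysis.
From mathcomp Require Import measurable_realfun ring lra.
Import Order.TTheory GRing.Theory Num.Theory.
Import numFieldNormedType.Exports.
Local Open Scope classical_set_scope.
Local Open Scope ring_scope.

(** * Monotonicity of the curve defining rho *)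

Lemma rho_curve_lt (R : realType) (x y : R) : 0 < x -> x < y ->
  (2 * expR (x - 1) - 1) / x ^+ 2 < (2 * expR (y - 1) - 1) / y ^+ 2.
Proof.
pose h (t : R) := (2 * expR (-1) * expR t - 1) * (t * t)^-1.
pose dh (t : R) := 2 * (expR (t - 1) * (t - 2) + 1) / t ^+ 3.
have dhE (t : R) : 0 < t -> is_derive t 1 h (dh t).
  move=> t0; have tn0 : t != 0 by rewrite gt_eqF.
  have dE : is_derive t 1 (fun u : R => 2 * expR (-1) * expR u - 1)
                          (2 * expR (-1) * expR t).
    have := is_deriveB (is_deriveZ (2 * expR (-1)) (is_derive_expR t))
                       (is_derive_cst (1 : R) t 1).
    by rewrite subr0; exact.
  have dV : is_derive t 1 (fun u : R => (u * u)^-1) (- (t * t)^-2 * (t + t)).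
    apply: (@is_deriveV R (fun u : R => u * u)); first by rewrite mulf_neq0.
    have := is_deriveM (is_derive_id t (1 : R)) (is_derive_id t (1 : R)).
    by rewrite /GRing.scale/= !mulr1; exact.
  apply: is_derive_eq (is_deriveM dE dV) _.
  by rewrite /dh /GRing.scale/= expRD; field.
(* The derivative [dh] vanishes at 1, so the mean value theorem gives strict growth on each side of
   1 separately; the two sides are glued at 1 at the end. *)
have hlt a b : 0 < a -> a < b -> (b <= 1) || (1 <= a) -> h a < h b.
  move=> a0 ab ab1.
  have [||c cab hE] := @MVT R h dh a b ab.
  - by move=> t; rewrite in_itv /= => /andP[at_ _]; apply: dhE; lra.
  - apply: derivable_within_continuous => t; rewrite in_itv /= => /andP[at_ _].
    by apply: (@ex_derive _ _ _ _ _ _ (dh t)); apply: dhE; lra.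
  move: cab; rewrite in_itv /= => /andP[ac cb].
  rewrite -subr_gt0 hE mulr_gt0 ?subr_gt0 //.
  have c0 : 0 < c by lra.
  have cn1 : 1 - c != 0.
    by rewrite subr_eq0; apply/eqP => c1; case/orP: ab1; lra.
  rewrite /dh divr_gt0 ?exprn_gt0 // mulr_gt0 //.
  (* The bound exp(1 - c) > 2 - c, strict as c is not 1, multiplied by exp(c - 1) is the positivity
     of the numerator of [dh c]. *)
  have E0 := expR_gt0 (c - 1).
  have := expR_gt1Dx cn1.
  rewrite -(opprB c 1) expRN -(ltr_pM2l E0) mulfV ?gt_eqF //.
  lra.
have hE t : (2 * expR (t - 1) - 1) / t ^+ 2 = h t.
  by rewrite /h expRD expr2 (mulrC (expR t)) mulrA.
move=> x0 xy; rewrite !hE.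
have [y1|y1] := lerP y 1; first by apply: hlt => //; rewrite y1.
have [x1|x1] := lerP 1 x; first by apply: hlt => //; rewrite x1 orbT.
by apply: (@lt_trans _ _ (h 1)); apply: hlt; rewrite ?lexx ?orbT.
Qed.

Lemma is_rho_le (R : realType) (r s a b : R) :
  0 <= r -> r <= s -> is_rho r a -> is_rho s b -> a <= b.
Proof.
move=> r0 rs [a0 ha] [b0 hb]; rewrite leNgt; apply/negP => ba.
have := rho_curve_lt _ _ _ b0 ba; rewrite ha hb ltNge => /negP; apply.
by rewrite lerD2r lerXn2r ?nnegrE //; lra.
Qed.

(** Over n + 1 equal pieces the losses add up to C (t - s)^2 / (n + 1), which tends to 0. This gives
    monotonicity without differentiating [f]. *)
Lemma le_of_quadratic_increments {R : realType} {f : R -> R} {C s t : R} :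
  s <= t ->
  (forall a b, s <= a -> a <= b -> b <= t -> - (C * (b - a) ^+ 2) <= f b - f a) ->
  f s <= f t.
Proof.
move=> st fC.
have C0 n : - (C * (t - s) ^+ 2) / n.+1%:R <= f t - f s.
  pose u k : R := s + (t - s) * (k%:R / n.+1%:R).
  have uS k : u k.+1 - u k = (t - s) / n.+1%:R.
    by rewrite /u -(natr1 k); field; rewrite nat1r pnatr_eq0.
  have un0 : 0 <= (t - s) / n.+1%:R by rewrite divr_ge0 ?subr_ge0.
  have u0 : u 0%N = s by rewrite /u mul0r mulr0 addr0.
  have un : u n.+1 = t by rewrite /u divff ?pnatr_eq0 // mulr1 addrC subrK.
  have uge k : s <= u k.
    by rewrite lerDl mulr_ge0 ?subr_ge0 ?divr_ge0.
  have ule k : (k <= n.+1)%N -> u k <= t.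
    move=> kn; rewrite /u -lerBrDl -[leRHS]mulr1 ler_wpM2l ?subr_ge0 //.
    by rewrite ler_pdivrMr ?ltr0n // mul1r ler_nat.
  have acc k : (k <= n.+1)%N ->
      - (C * ((t - s) / n.+1%:R) ^+ 2) *+ k <= f (u k) - f s.
    elim: k => [|k IH] kn; first by rewrite mulr0n u0 subrr.
    have := fC (u k) (u k.+1) (uge k); rewrite uS => /(_ _ (ule _ kn)).
    have ukk : u k <= u k.+1 by rewrite -subr_ge0 uS.
    move=> /(_ ukk); have := IH (ltnW kn).
    rewrite mulrS; lra.
  have := acc n.+1 (leqnn _); rewrite un; apply: le_trans.
  rewrite -mulr_natr le_eqVlt; apply/orP; left; apply/eqP.
  by field; rewrite nat1r pnatr_eq0.
rewrite leNgt; apply/negP => ts.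
have d0 : 0 < f s - f t by lra.
(* Enough pieces for the total loss to be smaller than the supposed drop [f s - f t]. *)
pose n := Num.truncn (`|C * (t - s) ^+ 2| / (f s - f t)).
have := C0 n; rewrite ler_pdivrMr ?ltr0n //.
have := truncnS_gt (`|C * (t - s) ^+ 2| / (f s - f t)).
rewrite -/n ltr_pdivrMr // => h1 h2.
have := ler_norm (C * (t - s) ^+ 2).
nra.
Qed.

(** * Expected payment under a posted random price *)

Definition posted_pay {R : realType} (P : probability R R) (v : R) : R :=
  fine (\int[P]_(p in [set p : R | (p <= v)%R]) p%:E)%E.

(** The probability of sale to a buyer of value [v], hence the expected allocation. *)
Definition cdf_at {R : realType} (P : probability R R) (v : R) : R :=
  fine (P [set p : R | p <= v]).

Section PostedPrice.
Context {R : realType} {P : probability R R}.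
Hypothesis P_le0 : P [set p : R | p <= 0] = 0%E.

Local Lemma measurable_halfline (v : R) : measurable [set p : R | p <= v].
Proof.
have -> : [set p : R | p <= v] = [set` `]-oo, v] ].
  by apply/seteqP; split => x /=; rewrite in_itv.
exact: measurable_itv.
Qed.

Local Lemma measurable_window (a b : R) : measurable [set p : R | a < p <= b].
Proof.
have -> : [set p : R | a < p <= b] = [set` `]a, b] ].
  by apply/seteqP; split => x /=; rewrite in_itv.
exact: measurable_itv.
Qed.

Local Lemma le_split (a b : R) : a <= b ->
  [set p : R | p <= b] = [set p | p <= a] `|` [set p | a < p <= b].
Proof.
move=> ab; apply/seteqP; split => p /= => [pb|[pa|/andP[_ //]]].
  by have [pa|pa] := lerP p a; [left|right; rewrite pb].
exact: le_trans pa ab.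
Qed.

Local Lemma le_disj (a b : R) :
  [disjoint [set p : R | p <= a] & [set p | a < p <= b]].
Proof.
by apply/eqP/seteqP; split => // p /= [pa /andP[ap _]]; move: ap; rewrite ltNge pa.
Qed.

Lemma cdf_atE (v : R) : P [set p : R | p <= v] = (cdf_at P v)%:E.
Proof. by rewrite /cdf_at fineK ?fin_num_measure //; exact: measurable_halfline. Qed.

Lemma cdf_at_bounds (v : R) : 0 <= cdf_at P v <= 1.
Proof.
rewrite -!lee_fin -cdf_atE measure_ge0 /=.
by apply: probability_le1; exact: measurable_halfline.
Qed.

Local Lemma prob_between (a b : R) : a <= b ->
  P [set p : R | a < p <= b] = (cdf_at P b - cdf_at P a)%:E.
Proof.
move=> ab; have := cdf_atE b; rewrite (le_split _ _ ab) measureU.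
- by rewrite [X in (X + _)%E]cdf_atE EFinB => <-; rewrite [X in (X - _)%E]addeC addeK.
- exact: measurable_halfline.
- exact: measurable_window.
- by apply/eqP; exact: le_disj.
Qed.

Local Lemma integral_le_nonpos (v : R) : v <= 0 ->
  (\int[P]_(p in [set p : R | (p <= v)%R]) p%:E = 0)%E.
Proof.
move=> v0; apply: null_set_integral.
- exact: measurable_halfline.
- exact: EFin_measurable.
- apply/eqP; rewrite eq_le measure_ge0 andbT -[leRHS]P_le0.
  apply: le_measure; rewrite ?inE; try exact: measurable_halfline.
  by move=> p /= /le_trans; apply.
Qed.

Local Lemma integral_between (a b : R) : 0 <= a -> a <= b ->
  ((a * (cdf_at P b - cdf_at P a))%:E
     <= \int[P]_(p in [set p : R | (a < p <= b)%R]) p%:E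
     <= (b * (cdf_at P b - cdf_at P a))%:E)%E.
Proof.
move=> a0 ab; rewrite !EFinM -!prob_between // -!integral_cst; try exact: measurable_window.
apply/andP; split; apply: ge0_le_integral => //; try exact: measurable_window;
  try exact: EFin_measurable.
- by move=> p /= /andP[/ltW].
- by move=> p /= /andP[/ltW ap _]; rewrite lee_fin (le_trans a0).
- by move=> p /= /andP[].
Qed.

(** Nonpositive prices form a null set, and the rest of the integral lies between finite bounds, so
    [fine] loses nothing. *)
Local Lemma posted_payE (v : R) : 0 <= v ->
  (posted_pay P v)%:E = (\int[P]_(p in [set p : R | (0 < p <= v)%R]) p%:E)%E.
Proof.
move=> v0; have /andP[l u] := integral_between _ _ (lexx 0) v0.
rewrite /posted_pay (le_split _ _ v0) integral_setU.
- rewrite integral_le_nonpos // add0e fineK // fin_numE.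
  by apply/andP; split; [rewrite gt_eqF // (lt_le_trans _ l) ?ltNyr|
                         rewrite lt_eqF // (le_lt_trans u) ?ltry].
- exact: measurable_halfline.
- exact: measurable_window.
- exact: EFin_measurable.
- exact: le_disj.
Qed.

Lemma posted_pay_nonpos (v : R) : v <= 0 -> posted_pay P v = 0.
Proof. by move=> v0; rewrite /posted_pay integral_le_nonpos. Qed.

(** Raising the value from a to b adds exactly the prices in (a, b], each of them between a and b.
    Monotonicity, truthfulness and the log-lottery bound all rest on these two inequalities. *)
Lemma posted_pay_incr (a b : R) : 0 <= a -> a <= b ->
  a * (cdf_at P b - cdf_at P a) <= posted_pay P b - posted_pay P a
    <= b * (cdf_at P b - cdf_at P a).
Proof.
move=> a0 ab; have := integral_between _ _ a0 ab.
suff -> : (\int[P]_(p in [set p : R | (a < p <= b)%R]) p%:E)%E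
    = (posted_pay P b - posted_pay P a)%:E by rewrite !lee_fin.
have split_ab : [set p : R | 0 < p <= b] = [set p | 0 < p <= a] `|` [set p | a < p <= b].
  apply/seteqP; split => p /= => [/andP[p0 pb]|[/andP[-> /le_trans ->]|/andP[ap ->]]] //.
    by have [pa|pa] := lerP p a; [left; rewrite p0|right; rewrite pb].
  by rewrite (le_lt_trans a0).
have disj : [disjoint [set p : R | 0 < p <= a] & [set p | a < p <= b]].
  apply/eqP/seteqP; split => // p /= [/andP[_ pa] /andP[ap _]].
  by move: ap; rewrite ltNge pa.
have := posted_payE _ (le_trans a0 ab).
rewrite split_ab integral_setU //; try exact: measurable_window.
  rewrite -posted_payE // EFinB => ->.
  by rewrite [X in (X - _)%E]addeC addeK.
Qed.

Lemma posted_pay_le (a b : R) : a <= b -> posted_pay P a <= posted_pay P b.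
Proof.
have cdf_le (c d : R) : c <= d -> 0 <= cdf_at P d - cdf_at P c.
  by move=> cd; rewrite -lee_fin -prob_between // measure_ge0.
have le0 (c d : R) : 0 <= c -> c <= d -> posted_pay P c <= posted_pay P d.
  move=> c0 cd; have /andP[+ _] := posted_pay_incr _ _ c0 cd.
  by rewrite -(subr_ge0 (posted_pay P c)); apply: le_trans; rewrite mulr_ge0 ?cdf_le.
move=> ab; have [a0|a0] := lerP 0 a; first exact: le0 _ _ a0 ab.
have [b0|b0] := lerP 0 b; last by rewrite !posted_pay_nonpos ?lexx ?ltW.
have := le0 _ _ (lexx 0) b0; rewrite (posted_pay_nonpos 0) //.
by rewrite (posted_pay_nonpos a (ltW a0)).
Qed.

Lemma posted_pay_ge0 (v : R) : 0 <= posted_pay P v.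
Proof.
have [v0|v0] := lerP 0 v; last by rewrite posted_pay_nonpos ?lexx ?ltW.
by have := posted_pay_le _ _ v0; rewrite (posted_pay_nonpos 0).
Qed.

Lemma measurable_posted_pay : measurable_fun setT (posted_pay P).
Proof. by apply: nondecreasing_measurable => // a b; exact: posted_pay_le. Qed.

(** The upper bound of [posted_pay_incr] deters reports below the value, the lower bound those above
    it. *)
Lemma posted_pay_truthful (v w : R) : 0 <= v -> 0 <= w ->
  cdf_at P w * v - posted_pay P w <= cdf_at P v * v - posted_pay P v.
Proof.
move=> v0 w0; have [wv|/ltW vw] := lerP w v.
  have /andP[_] := posted_pay_incr _ _ w0 wv; lra.
have /andP[+ _] := posted_pay_incr _ _ v0 vw; lra.
Qed.

Lemma posted_pay_rational (v : R) : 0 <= v -> 0 <= cdf_at P v * v - posted_pay P v.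
Proof.
(* The report 0 neither buys nor pays, so truthfulness against it is individual rationality. *)
move=> v0; have := posted_pay_truthful _ _ v0 (lexx 0).
by rewrite (posted_pay_nonpos 0) // /cdf_at P_le0 mul0r subrr.
Qed.

End PostedPrice.

(** * Log-lottery parameters and the payment they guarantee *)

Lemma is_rho0 (R : realType) : is_rho (0 : R) 1.
Proof. by split => //; rewrite subrr expR0; lra. Qed.

Section LogLotteryPrice.
Context {R : realType} {mu sigma p1 p2 : R}.
Hypotheses (mu0 : 0 < mu) (par : loglottery_params mu sigma p1 p2).

(** The first equation says exp(mu / p1 - 1) = p2 / p1; the second, divided by mu^2, is then the
    equation defining rho. *)
Lemma loglottery_rho : is_rho (sigma / mu) (mu / p1).
Proof.
have [p10 [p20 [E1 E2]]] := par.
split; first by rewrite divr_gt0.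
have -> : mu / p1 - 1 = ln (p2 / p1) by rewrite -E1; field; rewrite gt_eqF.
rewrite lnK ?posrE ?divr_gt0 //.
have -> : (sigma / mu) ^+ 2 + 1 = (mu ^+ 2 + sigma ^+ 2) / mu ^+ 2.
  by field; rewrite gt_eqF.
by rewrite -E2; field; rewrite !gt_eqF.
Qed.

(** At ratio 0, comparison with [is_rho0] in both directions forces mu / p1 = 1. *)
Lemma loglottery_degenerate : sigma = 0 -> p1 = mu.
Proof.
move=> s0; have := loglottery_rho; rewrite s0 mul0r => rho0.
have [p10 _] := par.
have le1 := is_rho_le _ _ _ _ _ (lexx 0) (lexx 0) rho0 (is_rho0 R).
have ge1 := is_rho_le _ _ _ _ _ (lexx 0) (lexx 0) (is_rho0 R) rho0.
have /eqP : mu / p1 = 1 by apply/eqP; rewrite eq_le le1 ge1.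
by rewrite -(inj_eq (mulIf (lt0r_neq0 p10))) mulfVK ?lt0r_neq0 // mul1r => /eqP.
Qed.

Hypothesis sigma0 : 0 < sigma.

(** This logarithm is rho - 1. Monotonicity gives rho >= 1, and rho = 1 would make the ratio
    [sigma / mu] zero. *)
Lemma ln_loglottery_ratio_gt0 : 0 < ln (p2 / p1).
Proof.
have [p10 [p20 [E1 E2]]] := par.
have r0 : 0 < sigma / mu by rewrite divr_gt0.
have := is_rho_le _ _ _ _ _ (lexx 0) (ltW r0) (is_rho0 R) loglottery_rho.
rewrite le_eqVlt => /orP[/eqP rho1|].
  have [_] := loglottery_rho; rewrite -rho1; have [_ ->] := is_rho0 R.
  by move=> h; have := exprn_gt0 2 r0; nra.
by rewrite ltr_pdivlMr // mul1r -E1 -{1}(mulr1 p1) ltr_pM2l // ltrDl.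
Qed.

Lemma loglottery_range : p1 < p2.
Proof.
have [p10 [p20 _]] := par; rewrite ltNge; apply/negP => p21.
have := ln_loglottery_ratio_gt0; rewrite ltNge => /negP; apply.
by apply: ln_le0; rewrite ler_pdivrMr // mul1r.
Qed.

(** With L = ln(p2 / p1) nonzero, exp(-L) > 1 - L; multiplied by p2 this reads p1 > p2 - p2 L. *)
Lemma loglottery_normalizer_gt0 : 0 < p2 * ln (p2 / p1) - (p2 - p1).
Proof.
have [p10 [p20 _]] := par; have L0 := ln_loglottery_ratio_gt0.
have : - ln (p2 / p1) != 0 by rewrite oppr_eq0 gt_eqF.
move=> /expR_gt1Dx; rewrite expRN lnK ?posrE ?divr_gt0 // invf_div.
rewrite -(ltr_pM2l p20) (mulrC p2 (p1 / p2)) mulfVK ?gt_eqF //.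
lra.
Qed.

(* The marginal payment of a value x in [p1, p2] is x times the price density,
   that is (p2 - x) / D, and the quadratic below is its primitive; as P is known
   only through its cdf, the two are compared up to O((b - a)^2) on small [a, b]. *)
Lemma loglottery_pay_ge (P : probability R R) (v : R) :
  (forall x, P [set y | y <= x] = (loglottery_cdf mu sigma p1 p2 x)%:E) ->
  P [set y | y <= 0] = 0%E ->
  ((p2 - p1) ^+ 2 - (p2 - v) ^+ 2) / (2 * (p2 * ln (p2 / p1) - (p2 - p1)))
    <= posted_pay P v.
Proof.
move=> cdfP Ple0; have [p10 [p20 _]] := par.
have D0 := loglottery_normalizer_gt0; have p12 := loglottery_range.
set D := p2 * ln (p2 / p1) - (p2 - p1) in D0 *.
pose Q (x : R) := ((p2 - p1) ^+ 2 - (p2 - x) ^+ 2) / (2 * D).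
have cdfE x : p1 <= x -> x <= p2 ->
    cdf_at P x = (p2 * (ln x - ln p1) - (x - p1)) / D.
  move=> x1 x2; rewrite /cdf_at cdfP /= /loglottery_cdf gt_eqF // ltNge x1 /=.
  rewrite -ln_div ?posrE //; last exact: lt_le_trans x1.
  (* At [p2] the cdf is in its constant branch, where the formula also equals 1. *)
  have [x2'|//] := lerP p2 x.
  have -> : x = p2 by apply/eqP; rewrite eq_le x2 x2'.
  by rewrite divff // gt_eqF.
have inc x : p1 <= x -> x <= p2 -> Q x <= posted_pay P x.
  move=> x1 x2; pose f y := posted_pay P y - Q y.
  have : f p1 <= f x.
    (* Replacing ln b - ln a by (b - a) / b costs p2 (b - a)^2 / b, at most (p2 / p1) (b - a)^2
       because b >= p1; the cdf carries the factor 1 / D. *)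
    apply: (le_of_quadratic_increments (C := p2 / p1 / D)) => // a b a1 ab bx.
    have a0 : 0 < a := lt_le_trans p10 a1.
    have b0 : 0 < b := lt_le_trans a0 ab.
    have /andP[+ _] := posted_pay_incr Ple0 _ _ (ltW a0) ab.
    rewrite !cdfE //; try lra.
    suff : Q b - Q a - p2 / p1 / D * (b - a) ^+ 2 <=
        a * ((p2 * (ln b - ln p1) - (b - p1)) / D -
             (p2 * (ln a - ln p1) - (a - p1)) / D) by rewrite /f; lra.
    rewrite -(ler_pM2r D0).
    have -> : (Q b - Q a - p2 / p1 / D * (b - a) ^+ 2) * D =
        ((p2 - a) ^+ 2 - (p2 - b) ^+ 2) / 2 - p2 / p1 * (b - a) ^+ 2.
      by rewrite /Q; field; rewrite !gt_eqF.
    have -> : a * ((p2 * (ln b - ln p1) - (b - p1)) / D -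
             (p2 * (ln a - ln p1) - (a - p1)) / D) * D =
        a * p2 * (ln b - ln a) - a * (b - a) by field; rewrite gt_eqF.
    have lnab : (b - a) / b <= ln b - ln a.
      have ab0 : 0 < a / b by rewrite divr_gt0.
      have := @le_ln1Dx R (a / b - 1); rewrite (addrC 1) subrK.
      have -> : -1 < a / b - 1 by rewrite -subr_gt0 opprK subrK.
      rewrite ln_div ?posrE // => /(_ isT).
      have -> : (b - a) / b = 1 - a / b by field; rewrite gt_eqF.
      lra.
    have ap0 : 0 <= a * p2 by rewrite mulr_ge0 ?ltW.
    have := ler_wpM2l ap0 lnab.
    have -> : a * p2 * ((b - a) / b) = p2 * (b - a) - p2 * ((b - a) ^+ 2 / b).
      by field; rewrite gt_eqF.
    have : p2 * ((b - a) ^+ 2 / b) <= p2 / p1 * (b - a) ^+ 2.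
      rewrite -mulrA ler_pM2l // mulrC ler_wpM2r ?sqr_ge0 //.
      by rewrite lef_pV2 ?posrE //; lra.
    have := sqr_ge0 (b - a); lra.
  have Q1 : Q p1 = 0 by rewrite /Q subrr mul0r.
  by have := posted_pay_ge0 Ple0 p1; rewrite /f Q1; lra.
(* Below [p1] the quadratic is negative; above [p2] it is past its vertex while the payment keeps
   growing. *)
rewrite -/(Q v); have [v1|v1] := lerP p1 v; last first.
  apply: le_trans (posted_pay_ge0 Ple0 v).
  rewrite /Q mulr_le0_ge0 ?invr_ge0 //; [nra|lra].
have [v2|/ltW v2] := lerP v p2; first exact: inc.
apply: le_trans (posted_pay_le Ple0 _ _ v2).
apply: le_trans (inc p2 (ltW p12) (lexx _)).
rewrite /Q ler_pM2r ?invr_gt0 ?mulr_gt0 // subrr expr0n /=.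
have := sqr_ge0 (p2 - v); lra.
Qed.

End LogLotteryPrice.

(** * Expectations from mean and variance *)

Lemma measurable_preimage_ge0 {d} {T : measurableType d} {R : realType} {X : T -> R} :
  measurable_fun setT X -> measurable [set t | 0 <= X t].
Proof.
move=> /(_ measurableT `[0, +oo[%classic (measurable_itv _)).
by rewrite setTI; congr measurable; apply/seteqP; split => t /=; rewrite in_itv /= andbT.
Qed.

Lemma integral_cst_prob {d} {T : measurableType d} {R : realType}
  (F : probability T R) (c : R) : (\int[F]_t c%:E = c%:E)%E.
Proof.
apply: etrans (integral_cst F measurableT c%:E) _.
apply: etrans (mule1 _); congr (_ * _)%E; exact: probability_setT.
Qed.

(** Almost surely X = |X|, so the finite mean is also the integral of |X|. *)
Lemma integrable_of_mean {d} {T : measurableType d} {R : realType}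
  (F : probability T R) (X : T -> R) (mu : R) :
  measurable_fun setT X -> F [set t | 0 <= X t] = 1%E ->
  (\int[F]_t (X t)%:E = mu%:E)%E -> F.-integrable setT (EFin \o X).
Proof.
move=> mX X0 EX.
have mEX : measurable_fun setT (EFin \o X) by exact/measurable_EFinP.
have mX0 := measurable_preimage_ge0 mX.
apply/integrableP; split => //.
rewrite (ae_eq_integral (EFin \o X)) //.
- by rewrite EX ltry.
- exact: measurableT_comp.
- exists (~` [set t | 0 <= X t]); split.
  + exact: measurableC.
  + by apply: etrans (probability_setC F mX0) _; rewrite X0 subee.
  + by move=> t /= h t0; apply: h => _; rewrite ger0_norm.
Qed.

Section QuadraticBound.
Context {d} {T : measurableType d} {R : realType} {F : probability T R}.
Context {X : T -> R} {mu s : R}.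
Hypotheses (iX : F.-integrable setT (EFin \o X))
  (EX : (\int[F]_t (X t)%:E = mu%:E)%E)
  (VX : (\int[F]_t ((X t - mu) ^+ 2)%:E <= (s ^+ 2)%:E)%E).

Local Lemma measurable_X : measurable_fun setT X.
Proof. by have /integrableP[/measurable_EFinP] := iX. Qed.

Local Lemma measurable_sqr_dev : measurable_fun setT (fun t => (X t - mu) ^+ 2).
Proof. by apply: measurable_funX; apply: measurable_funB => //; exact: measurable_X. Qed.

Lemma integrable_dev : F.-integrable setT (EFin \o (fun t => X t - mu)).
Proof.
have := integrableB measurableT iX (finite_measure_integrable_cst F mu measurableT).
exact.
Qed.

Lemma integrable_sqr_dev : F.-integrable setT (EFin \o (fun t => (X t - mu) ^+ 2)).
Proof.
apply/integrableP; split; first exact/measurable_EFinP/measurable_sqr_dev.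
under eq_integral do rewrite /= ger0_norm ?sqr_ge0 //.
by apply: le_lt_trans VX _; rewrite ltry.
Qed.

(** Integrating the quadratic minorant kills the linear term, and the square term costs at most c2
    s^2 since c2 >= 0. *)
Lemma integral_ge_quadratic (f : R -> R) (c0 c1 c2 : R) :
  measurable_fun setT f -> (forall x, 0 <= f x) -> 0 <= c2 ->
  (forall x, c0 + c1 * (x - mu) - c2 * (x - mu) ^+ 2 <= f x) ->
  ((c0 - c2 * s ^+ 2)%:E <= \int[F]_t (f (X t))%:E)%E.
Proof.
move=> mf f0 c20 fq.
have mfX : measurable_fun setT (EFin \o (fun t => f (X t))).
  by apply/measurable_EFinP; apply: measurableT_comp mf measurable_X.
(* An infinite integral satisfies the bound trivially; a finite one makes [f] of X integrable. *)
have [->|fin] := eqVneq (\int[F]_t (f (X t))%:E)%E +oo%E; first by rewrite leey.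
have ifX : F.-integrable setT (EFin \o (fun t => f (X t))).
  apply/integrableP; split => //.
  by under eq_integral do rewrite /= ger0_norm //; rewrite ltey.
pose q t := c0 + c1 * (X t - mu) - c2 * (X t - mu) ^+ 2.
have i0 := finite_measure_integrable_cst F c0 measurableT.
have i1 : F.-integrable setT (EFin \o (fun t => c1 * (X t - mu))).
  exact: (integrableZl measurableT c1 integrable_dev).
have i2 : F.-integrable setT (EFin \o (fun t => c2 * (X t - mu) ^+ 2)).
  exact: (integrableZl measurableT c2 integrable_sqr_dev).
have i01 : F.-integrable setT (EFin \o (fun t => c0 + c1 * (X t - mu))).
  exact: (integrableD measurableT i0 i1).
have iq : F.-integrable setT (EFin \o q).
  exact: (integrableB measurableT i01 i2).
apply: (@le_trans _ _ (\int[F]_t (q t)%:E)%E); last first.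
  by apply: le_integral => // t _; rewrite lee_fin; exact: fq.
have -> : (\int[F]_t (q t)%:E = c0%:E - c2%:E * \int[F]_t ((X t - mu) ^+ 2)%:E)%E.
  rewrite /q (integralB_EFin measurableT i01 i2); congr (_ - _)%E.
    have -> := integralD_EFin measurableT i0 i1.
    have -> := integralZl measurableT integrable_dev c1.
    have -> := integralB_EFin measurableT iX
                 (finite_measure_integrable_cst F mu measurableT).
    by rewrite EX !integral_cst_prob subee // mule0 adde0.
  exact: (integralZl measurableT integrable_sqr_dev c2).
rewrite EFinB EFinM leeB // lee_wpmul2l //.
Qed.

End QuadraticBound.

(** * Revenue of one log-lottery price *)

Lemma loglottery_le0 {R : realType} {mu sigma : R} {P : probability R R} :
  0 < mu -> is_loglottery mu sigma P -> P [set y | y <= 0] = 0%E.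
Proof.
move=> mu0 [p1 [p2 [[p10 _] ->]]]; rewrite /loglottery_cdf.
by have [_|_] := eqVneq sigma 0; rewrite ?leNgt ?mu0 ?p10.
Qed.

(** The revenue is at least p1, and p1 >= mu / rho by monotonicity of rho. An arbitrary random value
    X serves both a single item and the whole bundle. *)
Lemma loglottery_revenue {d} {T : measurableType d} {R : realType}
  (F : probability T R) (X : T -> R) (mu sigma r rho : R) (P : probability R R) :
  0 < mu -> 0 <= sigma -> is_loglottery mu sigma P ->
  sigma / mu <= r -> is_rho r rho ->
  F.-integrable setT (EFin \o X) ->
  (\int[F]_t (X t)%:E = mu%:E)%E ->
  (\int[F]_t ((X t - mu) ^+ 2)%:E <= (sigma ^+ 2)%:E)%E ->
  ((mu / rho)%:E <= \int[F]_t (posted_pay P (X t))%:E)%E.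
Proof.
move=> mu0 s0 LL sr hrho iX EX VX.
have Ple0 := loglottery_le0 mu0 LL.
have [p1 [p2 [par cdfP]]] := LL; have [p10 [p20 [E1 E2]]] := par.
have rho1 : mu / p1 <= rho.
  apply: is_rho_le sr (loglottery_rho mu0 par) hrho.
  by rewrite divr_ge0 // ltW.
have rho0 : 0 < rho by case: hrho.
apply: (@le_trans _ _ p1%:E).
  by rewrite lee_fin ler_pdivrMr // mulrC -ler_pdivrMr.
have mX : measurable_fun setT X by have /integrableP[/measurable_EFinP] := iX.
have mpay := measurable_posted_pay Ple0.
have [sz|sn] := eqVneq sigma 0; last first.
  have sp : 0 < sigma by rewrite lt_neqAle eq_sym sn.
  have D0 := loglottery_normalizer_gt0 mu0 par sp.
  set D := p2 * ln (p2 / p1) - (p2 - p1) in D0.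
  (* These coefficients expand the quadratic of [loglottery_pay_ge] around [mu]. *)
  have := integral_ge_quadratic iX EX VX _
    (((p2 - p1) ^+ 2 - (p2 - mu) ^+ 2) / (2 * D)) ((p2 - mu) / D) (2 * D)^-1
    mpay (posted_pay_ge0 Ple0).
  have -> : ((p2 - p1) ^+ 2 - (p2 - mu) ^+ 2) / (2 * D) - (2 * D)^-1 * sigma ^+ 2
      = p1.
    rewrite mulrC -mulrBr.
    have -> : (p2 - p1) ^+ 2 - (p2 - mu) ^+ 2 - sigma ^+ 2 =
       2 * p2 * (mu - p1) + p1 ^+ 2 - (mu ^+ 2 + sigma ^+ 2) by ring.
    rewrite -E2 -E1.
    have -> : 2 * p2 * (p1 * (1 + ln (p2 / p1)) - p1) + p1 ^+ 2
      - p1 * (2 * p2 - p1) = (2 * D) * p1 by rewrite /D; ring.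
    by rewrite mulKf // gt_eqF // mulr_gt0.
  apply; first by rewrite invr_ge0 mulr_ge0 ?ltW.
  move=> x; apply: le_trans (loglottery_pay_ge mu0 par sp P x cdfP Ple0).
  rewrite -/D le_eqVlt; apply/orP; left; apply/eqP.
  by field; rewrite gt_eqF.
rewrite (loglottery_degenerate mu0 par sz).
have pay_mu : mu <= posted_pay P mu.
  rewrite leNgt; apply/negP => lt_mu.
  (* The price is a point mass at [mu], so the window (a, mu] already yields a payment of at least
     a, which exceeds the supposed payment. *)
  pose a := (mu + posted_pay P mu) / 2.
  have pay0 := posted_pay_ge0 Ple0 mu.
  have a0 : 0 <= a by rewrite /a; lra.
  have amu : a < mu by rewrite /a; lra.
  have /andP[+ _] := posted_pay_incr Ple0 _ _ a0 (ltW amu).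
  rewrite /cdf_at !cdfP /loglottery_cdf sz eqxx lexx (lt_geF amu) /= subr0 mulr1.
  have := posted_pay_ge0 Ple0 a; rewrite /a; lra.
(* Zero variance makes X equal to [mu] almost surely. *)
have V0 : (\int[F]_t `|((X t - mu) ^+ 2)%:E| = 0)%E.
  under eq_integral do rewrite /= ger0_norm ?sqr_ge0 //.
  apply/eqP; rewrite eq_le integral_ge0 ?andbT; last first.
    by move=> t _; rewrite lee_fin sqr_ge0.
  by move: VX; rewrite sz expr0n.
have msq : measurable_fun setT (fun t => ((X t - mu) ^+ 2)%:E).
  apply/measurable_EFinP/measurable_funX.
  exact: measurable_funB.
have [+ _] := ae_eq_integral_abs F measurableT msq.
move=> /(_ V0) aeX.
have -> : (mu%:E = \int[F]_t (cst mu%:E) t)%E.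
  exact/esym/integral_cst_prob.
apply: ae_ge0_le_integral => //.
- by move=> t _; rewrite lee_fin ltW.
- by move=> t _; rewrite lee_fin posted_pay_ge0.
- by apply/measurable_EFinP; exact: measurableT_comp.
- move: aeX; apply: filterS => t /(_ I) /= [] /eqP.
  by rewrite sqrf_eq0 subr_eq0 => /eqP -> _; rewrite lee_fin.
Qed.

(** * Moments of the class and the welfare bound *)

Section Class.
Context {R : realType} {m : nat} {mu sigma : 'I_m -> R}.
Context {F : probability (vals R m) R}.
Hypothesis FC : in_class mu sigma F.

Local Lemma measurable_nonneg_vec : measurable [set v : vals R m | nonneg_vec v].
Proof.
have -> : [set v : vals R m | nonneg_vec v] =
    \bigcap_(j in [set: 'I_m]) [set v | 0 <= tnth v j].
  by apply/seteqP; split => v /= h j; [move=> _|]; exact: h.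
apply: fin_bigcap_measurable => [|j _]; first exact: finite_finset.
exact: measurable_preimage_ge0 (measurable_tnth j).
Qed.

Lemma ae_nonneg_vec : {ae F, forall v, nonneg_vec v}.
Proof.
exists (~` [set v | nonneg_vec v]); split => //.
  exact: measurableC measurable_nonneg_vec.
apply: etrans (probability_setC F measurable_nonneg_vec) _.
by case: FC => -> _; rewrite subee.
Qed.

Lemma coord_integrable (j : 'I_m) : F.-integrable setT (EFin \o (fun v => tnth v j)).
Proof.
case: FC => F1 /(_ j)[EX _].
apply: integrable_of_mean EX; first exact: measurable_tnth.
have mj : measurable [set v : vals R m | 0 <= tnth v j].
  exact: measurable_preimage_ge0 (measurable_tnth j).
apply/eqP; rewrite eq_le probability_le1 //= -F1.
by apply: le_measure => [||v]; rewrite ?inE //=; exact: measurable_nonneg_vec.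
Qed.

Lemma measurable_total : measurable_fun setT (fun v : vals R m => \sum_(j < m) tnth v j).
Proof. by apply: measurable_sum => j; exact: measurable_tnth. Qed.

Lemma total_integrable :
  F.-integrable setT (EFin \o (fun v : vals R m => \sum_(j < m) tnth v j)).
Proof.
rewrite (_ : EFin \o _ = fun v : vals R m => (\sum_(j < m) (tnth v j)%:E)%E); last first.
  by apply/funext => v /=; rewrite sumEFin.
by apply: integrable_sum => // j _; exact: coord_integrable.
Qed.

Lemma total_mean : (\int[F]_v (\sum_(j < m) tnth v j)%:E = (\sum_(j < m) mu j)%:E)%E.
Proof.
under eq_integral do rewrite -sumEFin.
rewrite integral_sum //; last by move=> j; exact: coord_integrable.
rewrite -sumEFin; apply: eq_bigr => j _.
by case: FC => _ /(_ j)[].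
Qed.

Lemma pay_le_total (M : mechanism R m) (v : vals R m) :
  truthful M -> nonneg_vec v -> pay M v <= \sum_(j < m) tnth v j.
Proof.
move=> [al [_ [_ ir]]] v0; have := ir v v0; rewrite /utility subr_ge0 => /le_trans.
apply; apply: ler_sum => j _; have /andP[a0 a1] := al v v0 j.
by rewrite ler_piMl ?v0.
Qed.

Lemma OPT_le : (OPT F <= (\sum_(j < m) mu j)%:E)%E.
Proof.
apply: ge_ereal_sup => _ [M [tM mM] <-].
rewrite /REV -total_mean.
have mp : measurable_fun setT (EFin \o pay M) by exact/measurable_EFinP.
have mt : measurable_fun setT (EFin \o (fun v : vals R m => \sum_(j < m) tnth v j)).
  by apply/measurable_EFinP; exact: measurable_total.
have pay0 v : nonneg_vec v -> 0 <= pay M v by case: tM => _ [h _]; exact: h.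
have tot0 (v : vals R m) : nonneg_vec v -> 0 <= \sum_(j < m) tnth v j.
  by move=> v0; apply: sumr_ge0 => j _; exact: v0.
(* Truthfulness constrains [pay M] on nonnegative vectors only, an event of probability 1. Absolute
   values make both integrands nonnegative everywhere without changing the integrals. *)
rewrite (ae_eq_integral (abse \o (EFin \o pay M))) //; last first.
- move: ae_nonneg_vec; apply: filterS => v v0 _ /=.
  by rewrite ger0_norm ?pay0.
- exact: measurableT_comp.
rewrite [leRHS](ae_eq_integral (abse \o
    (EFin \o (fun v : vals R m => \sum_(j < m) tnth v j)))) //; last first.
- move: ae_nonneg_vec; apply: filterS => v v0 _ /=.
  by rewrite ger0_norm ?tot0.
- exact: measurableT_comp.
apply: ae_ge0_le_integral => //.
- by move=> v _; rewrite lee_fin.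
- exact: measurableT_comp.
- by move=> v _; rewrite lee_fin.
- exact: measurableT_comp.
- move: ae_nonneg_vec; apply: filterS => v v0 _ /=.
  by rewrite lee_fin !ger0_norm ?pay0 ?tot0 // pay_le_total.
Qed.

End Class.

(** * Revenue ratio and admissibility *)

Lemma eratio_le {R : realType} (a b : \bar R) (mubar rho : R) :
  0 < mubar -> 0 < rho -> (a <= mubar%:E)%E -> ((mubar / rho)%:E <= b)%E ->
  (eratio a b <= rho%:E)%E.
Proof.
(* An infinite revenue has ratio 0 by convention; the lower bound on [b] excludes zero and -oo. *)
move=> m0 r0 am; case: b => [r| |] //=; last by move=> _; rewrite lee_fin ltW.
rewrite lee_fin => mr.
have rp : 0 < r by apply: lt_le_trans mr; rewrite divr_gt0.
rewrite gt_eqF //.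
apply: (@le_trans _ _ (mubar%:E * (r^-1)%:E)%E).
  by rewrite lee_wpmul2r // lee_fin invr_ge0 ltW.
by rewrite -EFinM lee_fin ler_pdivrMr // -ler_pdivrMl // mulrC.
Qed.

Lemma separate_posted_admissible {R : realType} {m : nat} (P : 'I_m -> probability R R) :
  (forall j, P j [set y | y <= 0] = 0%E) -> admissible (separate_posted P).
Proof.
move=> P0.
(* Additivity splits the utility over the items, so each requirement reduces to a single posted
   price. *)
have uE w v : utility (separate_posted P) w v =
    \sum_(j < m) (cdf_at (P j) (tnth w j) * tnth v j - posted_pay (P j) (tnth w j)).
  by rewrite sumrB.
split; first (split; [|split; [|split]]).
- by move=> v v0 j; exact: cdf_at_bounds.
- by move=> v v0; apply: sumr_ge0 => j _; exact: posted_pay_ge0.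
- move=> v w v0 w0; rewrite !uE; apply: ler_sum => j _.
  exact: posted_pay_truthful.
- move=> v v0; rewrite uE; apply: sumr_ge0 => j _.
  exact: posted_pay_rational.
- apply: measurable_sum => j.
  apply: (measurableT_comp (measurable_posted_pay (P0 j))).
  exact: measurable_tnth.
Qed.

(** * Independence and the variance of the total *)

Lemma integral_mul_indep {d} {T : measurableType d} {R : realType}
  (F : probability T R) (X Y : T -> R) :
  F.-integrable setT (EFin \o X) -> F.-integrable setT (EFin \o Y) ->
  F.-integrable setT (EFin \o (fun t => X t * Y t)) ->
  (forall A B, measurable A -> measurable B ->
     F [set t | A (X t) /\ B (Y t)] = (F [set t | A (X t)] * F [set t | B (Y t)])%E) ->
  (\int[F]_t (X t * Y t)%:E = (\int[F]_t (X t)%:E) * (\int[F]_t (Y t)%:E))%E.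
Proof.
move=> iX iY iXY indep.
have mX : measurable_fun setT X by have /integrableP[/measurable_EFinP] := iX.
have mY : measurable_fun setT Y by have /integrableP[/measurable_EFinP] := iY.
pose X' : {mfun T >-> R} := mfun_Sub (mem_set mX).
pose Y' : {mfun T >-> R} := mfun_Sub (mem_set mY).
pose Z : {mfun T >-> (R * R)%type} := mfun_Sub (mem_set (measurable_fun_pair mX mY)).
(* Independence is agreement on rectangles, which identifies the joint law with the product of the
   marginal laws; Fubini then factors the integral. *)
have jointE A : measurable A ->
    (distribution F X' \x distribution F Y')%E A = distribution F Z A.
  by apply: product_measure_unique => A' B' mA mB; exact: indep.
pose f (z : R * R) : \bar R := (z.1 * z.2)%:E.
have mf : measurable_fun setT f.
  by apply/measurable_EFinP; apply: measurable_funM.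
have iZ : (distribution F Z).-integrable setT f.
  by apply: integrable_pushforward.
have iXxY : (distribution F X' \x distribution F Y')%E.-integrable setT f.
  apply/integrableP; split => //.
  rewrite (eq_measure_integral (distribution F Z)); last by move=> A mA _; exact: jointE.
  by have /integrableP[] := iZ.
have EX : (\int[distribution F X']_x x%:E = \int[F]_t (X t)%:E)%E.
  by rewrite integral_distribution.
have EY : (\int[distribution F Y']_y y%:E = \int[F]_t (Y t)%:E)%E.
  by rewrite integral_distribution.
have iX' : (distribution F X').-integrable setT (EFin \o id).
  by apply: integrable_pushforward => //; exact: EFin_measurable.
have iY' : (distribution F Y').-integrable setT (EFin \o id).
  by apply: integrable_pushforward => //; exact: EFin_measurable.
transitivity (\int[distribution F Z]_z f z)%E.
  by rewrite integral_distribution.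
transitivity (\int[distribution F X' \x distribution F Y']_z f z)%E.
  by apply/esym/eq_measure_integral => A mA _; exact: jointE.
rewrite -integral12_prod_meas1 // /fubini_F.
have [e eE] : exists e : R, (\int[F]_t (Y t)%:E)%E = e%:E.
  by exists (fine (\int[F]_t (Y t)%:E)%E); rewrite fineK // integrable_fin_num.
under eq_integral => x _.
  rewrite /f /=.
  have -> := integralZl measurableT iY' x.
  rewrite EY eE muleC.
  over.
by rewrite (integralZl measurableT iX') EX eE muleC.
Qed.

Section TotalVariance.
Context {R : realType} {m : nat} {mu sigma : 'I_m -> R}.
Context {F : probability (vals R m) R}.
Hypotheses (FC : in_class mu sigma F) (indep : product_dist F).

Local Notation dev j := (fun v : vals R m => tnth v j - mu j).

Local Lemma coord_dev_integrable j : F.-integrable setT (EFin \o dev j).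
Proof. exact: integrable_dev (coord_integrable FC j). Qed.

Local Lemma coord_sqr_dev_integrable j :
  F.-integrable setT (EFin \o (fun v : vals R m => dev j v ^+ 2)).
Proof.
by case: FC => _ /(_ j)[EX VX]; apply: integrable_sqr_dev (coord_integrable FC j) VX.
Qed.

Local Lemma dev_mul_integrable i j :
  F.-integrable setT (EFin \o (fun v : vals R m => dev i v * dev j v)).
Proof.
have i2 := integrableD measurableT (coord_sqr_dev_integrable i) (coord_sqr_dev_integrable j).
apply: le_integrable i2 => //.
  apply/measurable_EFinP; apply: measurable_funM.
    by have /integrableP[/measurable_EFinP] := coord_dev_integrable i.
  by have /integrableP[/measurable_EFinP] := coord_dev_integrable j.
(* The domination is |ab| <= a^2 + b^2. *)
move=> v _; rewrite lee_fin /= [leRHS]ger0_norm ?addr_ge0 ?sqr_ge0 //.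
move: (tnth v i - mu i) (tnth v j - mu j) => a b.
have := sqr_ge0 (a + b); have := sqr_ge0 (a - b).
have := sqr_ge0 a; have := sqr_ge0 b.
by rewrite ler_norml => *; apply/andP; split; lra.
Qed.

Local Lemma dev_mul_mean i j : i != j ->
  (\int[F]_v (dev i v * dev j v)%:E = 0)%E.
Proof.
move=> ij; have /= -> := integral_mul_indep F (dev i) (dev j)
  (coord_dev_integrable i) (coord_dev_integrable j) (dev_mul_integrable i j) _.
  have -> := integralB_EFin measurableT (coord_integrable FC i)
    (finite_measure_integrable_cst F (mu i) measurableT).
  by case: FC => _ /(_ i)[-> _]; rewrite integral_cst_prob subee // mul0e.
move=> A B mA mB.
(* Pairwise independence comes from boxes that are the whole line except at i and j, with A and B
   shifted by the means. *)
pose C k : set R := if k == i then [set x | A (x - mu i)]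
                    else if k == j then [set x | B (x - mu j)] else setT.
have mshift (c : R) D : measurable D -> measurable [set x : R | D (x - c)].
  move=> mD; rewrite -[X in measurable X]setTI.
  by apply: measurable_funB.
have mC k : measurable (C k).
  by rewrite /C; case: ifP => _; [|case: ifP => _]; auto.
have := indep C mC.
rewrite (bigD1 i) //= (bigD1 j) 1?eq_sym //= big1 ?mule1; last first.
  move=> k /andP[ki kj]; rewrite /C (negbTE ki) (negbTE kj).
  exact: probability_setT.
rewrite /C eqxx eq_sym (negbTE ij) eqxx => <-.
congr (F _); apply/seteqP; split => v /= => [[Ai Bj] k|h].
  by case: ifP => [/eqP -> //|_]; case: ifP => [/eqP -> //|_].
by have := h i; have := h j; rewrite !eqxx eq_sym (negbTE ij).
Qed.

(** The square expands into a double sum of products of deviations; the cross terms integrate to 0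
    and the diagonal is bounded item by item. *)
Lemma total_variance :
  (\int[F]_v ((\sum_(j < m) tnth v j - \sum_(j < m) mu j) ^+ 2)%:E
     <= (\sum_(j < m) sigma j ^+ 2)%:E)%E.
Proof.
have -> : (\int[F]_v ((\sum_(j < m) tnth v j - \sum_(j < m) mu j) ^+ 2)%:E =
    \int[F]_v \sum_(i < m) \sum_(j < m) (dev i v * dev j v)%:E)%E.
  apply: eq_integral => v _; rewrite -sumrB expr2 big_distrl /= -sumEFin.
  by apply: eq_bigr => i _; rewrite big_distrr /= sumEFin.
rewrite integral_sum //; last first.
  by move=> i; apply: integrable_sum => // j _; exact: dev_mul_integrable.
rewrite -sumEFin; apply: lee_sum => i _.
rewrite integral_sum //; last by move=> j; exact: dev_mul_integrable.
rewrite (bigD1 i) //= big1 ?adde0; last by move=> j ji; rewrite dev_mul_mean // eq_sym.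
by case: FC => _ /(_ i)[].
Qed.

End TotalVariance.

(** * The two revenue guarantees *)

Theorem theorem4 (R : realType) (m : nat) (hm : (0 < m)%N)
  (mu sigma : 'I_m -> R)
  (hmu : forall j, 0 < mu j) (hsigma : forall j, 0 <= sigma j) :
  (* (i) separate selling with independent log-lottery prices *)
  (forall (P : 'I_m -> probability R R),
     (forall j, is_loglottery (mu j) (sigma j) (P j)) ->
     forall rho : R,
       is_rho (\big[Num.max/0]_(j < m) (sigma j / mu j)) rho ->
       (forall F : probability (vals R m) R, in_class mu sigma F ->
          (eratio (OPT F) (REV (separate_posted P) F) <= rho%:E)%E) /\
       (APX mu sigma <= rho%:E)%E) /\
  (* (ii) grand bundle with a log-lottery price, product distributions *)
  (let mubar := \sum_(j < m) mu j in
   let sigmabar := Num.sqrt (\sum_(j < m) sigma j ^+ 2) in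
   forall Q : probability R R, is_loglottery mubar sigmabar Q ->
   forall rho : R, is_rho (sigmabar / mubar) rho ->
   forall F : probability (vals R m) R, in_class mu sigma F -> product_dist F ->
     (eratio (OPT F) (REV (bundle_posted m Q) F) <= rho%:E)%E).
Proof.
split=> [P LL rho hrho|mubar sigmabar Q LL rho hrho F FC indep].
- have rho0 : 0 < rho by case: hrho.
  have P0 j := loglottery_le0 (hmu j) (LL j).
  have mubar0 : 0 < \sum_(j < m) mu j.
    by rewrite (bigD1 (Ordinal hm)) //= ltr_pwDl // sumr_ge0 // => j _; exact: ltW.
  have ratio F : in_class mu sigma F ->
      (eratio (OPT F) (REV (separate_posted P) F) <= rho%:E)%E.
    move=> FC; apply: (eratio_le _ _ _ _ mubar0 rho0 (OPT_le FC)).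
    (* The target is the sum of the [mu j / rho], met item by item; only the marginals enter, so
       correlation is harmless. *)
    rewrite mulr_suml -sumEFin /REV.
    under eq_integral do rewrite /= -sumEFin.
    rewrite ge0_integral_sum //.
    + apply: lee_sum => j _.
      case: (FC) => _ /(_ j)[EX VX].
      apply: loglottery_revenue hrho (coord_integrable FC j) EX VX => //.
      exact: (le_bigmax_cond 0 (fun j => sigma j / mu j)).
    + move=> j; apply/measurable_EFinP.
      apply: (measurableT_comp (measurable_posted_pay (P0 j))).
      exact: measurable_tnth.
    + by move=> j v _; rewrite lee_fin; exact: posted_pay_ge0.
  split=> //; apply: ereal_inf_le; exists (ereal_sup
      [set eratio (OPT F) (REV (separate_posted P) F) | F in in_class mu sigma]).
    by exists (separate_posted P) => //; exact: separate_posted_admissible.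
  by apply: ge_ereal_sup => _ [F FC <-]; exact: ratio.
- have rho0 : 0 < rho by case: hrho.
  have mubar0 : 0 < mubar.
    by rewrite /mubar (bigD1 (Ordinal hm)) //= ltr_pwDl // sumr_ge0 // => j _; exact: ltW.
  apply: (eratio_le _ _ _ _ mubar0 rho0 (OPT_le FC)).
  (* The bundle payment is [posted_pay Q] at the total value, so the bound for one price applies to
     the sum. *)
  apply: loglottery_revenue LL (lexx _) hrho (total_integrable FC) (total_mean FC) _ => //.
    exact: sqrtr_ge0.
  rewrite sqr_sqrtr; first exact: total_variance.
  by apply: sumr_ge0 => j _; exact: sqr_ge0.
Qed.
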